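(* Let $A \in \mathbb{R}^{n\times n}$ be a stable matrix, let $V = \{b_1,\dots,b_M\}$ be a set of possible input matrix columns $b_i\in\mathbb{R}^n$, and for $S \subseteq V$ let $W_S$ be the controllability Gramian associated with $S$. Assume that $W_S$ is invertible for every $S \subseteq V$. Then the set function $f : 2^{V}\to \mathbb{R}$ defined by $$f(S) = \log\det W_{S}$$ is submodular.
   Context: A matrix $A$ is stable if all its eigenvalues have negative real part. A (possibly empty) existing input matrix $B_0$ with $n$ rows is fixed. For $S\subseteq V$, $B_S = [B_0 \;\; b_s]_{s\in S}$ is the matrix whose columns are those of $B_0$ together with the columns $b_s$ in $S$. The (infinite-horizon) controllability Gramian associated with $S$ is $$W_S = \int_0^\infty e^{A\tau} B_S B_S^T e^{A^T\tau}\,d\tau,$$ equivalently the unique positive semidefinite solution of the Lyapunov equation $A W_S + W_S A^T + B_S B_S^T = 0$. A set function $f : 2^V \to \mathbb{R}$ is submodular if for all subsets $X\subseteq Y\subseteq V$ and all $a\in V\setminus Y$, $$f(X\cup\{a\}) - f(X) \ge f(Y\cup\{a\}) - f(Y).$$ *)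

(* Defs.v *)
From HB Require Import structures.
From mathcomp Require Import all_boot all_order all_algebra.
From mathcomp Require Import complex.
From mathcomp Require Import all_classical all_reals all_analysis.

Set Implicit Arguments.
Unset Strict Implicit.
Unset Printing Implicit Defensive.

Import Order.TTheory GRing.Theory Num.Theory.
Import numFieldNormedType.Exports.

Local Open Scope classical_set_scope.
Local Open Scope ring_scope.

(* The eigenvalues of a real matrix are its complex ones, so A is first mapped
   into R[i]. *)
Definition stable_matrix (R : realType) (n : nat) (A : 'M[R]_n) : Prop :=
  forall z : R[i],
    eigenvalue (map_mx (real_complex R) A) z -> complex.Re z < 0.

(* The limit is taken in the topology of entrywise convergence on 'M[R]_n. *)
Definition expmx (R : realType) (n : nat) (A : 'M[R]_n) : 'M[R]_n :=
  limn (series (fun k : nat => (k`!%:R)^-1 *: A ^+ k)).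

(* The set of candidate columns is the indexed family b, and a subset S is a set
   of indices; enum_val lists the columns selected by S in increasing order of
   index. B0 is empty when m = 0. *)
Definition input_matrix (R : realType) (n m M : nat) (B0 : 'M[R]_(n, m))
    (b : 'I_M -> 'cV[R]_n) (S : {set 'I_M}) : 'M[R]_(n, m + #|S|) :=
  row_mx B0 (\matrix_(i < n, k < #|S|) b (enum_val k) i ord0).

(* The matrix-valued integral over [0, +oo[ is taken entry by entry. *)
Definition gramian (R : realType) (n p : nat) (A : 'M[R]_n)
    (B : 'M[R]_(n, p)) : 'M[R]_n :=
  \matrix_(i < n, j < n)
    \int[@lebesgue_measure R]_(t in `[0, +oo[)
      (expmx (t *: A) *m B *m B^T *m expmx (t *: A^T)) i j.

Definition submodular (R : realType) (T : finType) (f : {set T} -> R) : Prop :=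
  forall (X Y : {set T}) (a : T), X \subset Y -> a \notin Y ->
    f (a |: X) - f X >= f (a |: Y) - f Y.

(* Main.v *)
Require Import Defs.
From HB Require Import structures.
From mathcomp Require Import all_boot all_order all_algebra.
From mathcomp Require Import complex.
From mathcomp Require Import all_classical all_reals all_analysis.
From mathcomp Require Import spectral mxred ring lra.
Import Order.TTheory GRing.Theory Num.Theory.
Import numFieldNormedType.Exports.
Local Open Scope classical_set_scope.
Local Open Scope ring_scope.

Set Implicit Arguments.
Unset Strict Implicit.
Unset Printing Implicit Defensive.

(** The Gramian of [A] and [B] is the integral over the half-line of
    [e^(tA) B B^T e^(tA^T)].  As a function of [B B^T] it is linear, provided
    that the integral converges, and [B_S B_S^T] is the sum of [B0 B0^T] and of
    the [b_s b_s^T] for [s] in [S].  Hence [W_S] is a fixed positive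
    semidefinite matrix plus the sum over [s] in [S] of positive semidefinite
    matrices ([gramian_input], [gramian_psd]), and the theorem becomes a
    statement of linear algebra: if [X <= Y] in the Loewner order, adding a
    positive semidefinite [C] multiplies [\det X] at least as much as [\det Y]
    ([det_increment_anti]).

    For the determinants, factor [C] as [L L^T] and add its columns one at a
    time.  The matrix determinant lemma gives
    [\det (X + c c^T) = \det X * (1 + c^T X^-1 c)], and [X^-1] decreases when
    [X] increases, so every single factor is larger for [X] than for [Y].

    Convergence is where stability enters.  A complex Schur triangularization
    of [A], with its rows rescaled by powers of a small number so that the
    diagonal dominates, yields a positive definite [P] such that
    [x^T P A x <= - c * x^T P x] for some [c > 0] ([lyapunov]).  Along a
    trajectory [x' = A x] the energy [x^T P x] therefore decays exponentially,
    and so do the entries of [e^(tA)] ([expmx_decay]).  That [e^(tA)] solves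
    this equation is obtained entry by entry from the termwise differentiation
    of power series ([is_derive_expmx]). *)

(** * Positive semidefinite matrices and determinants *)

Section PositiveSemidefinite.
Variables (R : realType) (n : nat).
Implicit Types (M X Y C L : 'M[R]_n) (x y c : 'cV[R]_n).

Definition bform M x y : R := (x^T *m M *m y) 0 0.

Definition psd M : Prop := M^T = M /\ forall x, 0 <= bform M x x.

Lemma bformDl M x y z : bform M (x + y) z = bform M x z + bform M y z.
Proof. by rewrite /bform linearD /= !mulmxDl mxE. Qed.

Lemma bformDr M x y z : bform M x (y + z) = bform M x y + bform M x z.
Proof. by rewrite /bform mulmxDr mxE. Qed.

Lemma bformZl M a x y : bform M (a *: x) y = a * bform M x y.
Proof. by rewrite /bform linearZ /= -!scalemxAl mxE. Qed.

Lemma bformZr M a x y : bform M x (a *: y) = a * bform M x y.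
Proof. by rewrite /bform -!scalemxAr mxE. Qed.

Lemma bformD M1 M2 x y : bform (M1 + M2) x y = bform M1 x y + bform M2 x y.
Proof. by rewrite /bform mulmxDr mulmxDl mxE. Qed.

Lemma bformB M1 M2 x y : bform (M1 - M2) x y = bform M1 x y - bform M2 x y.
Proof. by rewrite /bform mulmxBr mulmxBl !mxE. Qed.

Lemma bformC M x y : M^T = M -> bform M x y = bform M y x.
Proof.
move=> Ms.
by rewrite /bform -[x^T *m M *m y]trmxK mxE !trmx_mul trmxK Ms mulmxA.
Qed.

Lemma psdD M1 M2 : psd M1 -> psd M2 -> psd (M1 + M2).
Proof.
move=> [s1 p1] [s2 p2]; split=> [|x]; first by rewrite linearD /= s1 s2.
by rewrite bformD addr_ge0.
Qed.

Lemma psd0 : psd 0.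
Proof. by split=> [|x]; rewrite ?trmx0 // /bform mulmx0 mul0mx mxE. Qed.

Lemma psd_sum (I : finType) (A : {pred I}) (F : I -> 'M[R]_n) :
  (forall i, i \in A -> psd (F i)) -> psd (\sum_(i in A) F i).
Proof.
by move=> pF; apply: (big_ind psd) => //; [exact: psd0|exact: psdD].
Qed.

Lemma psd_gram (p : nat) (L : 'M[R]_(n, p)) : psd (L *m L^T).
Proof.
split=> [|x]; first by rewrite trmx_mul trmxK.
rewrite /bform mulmxA -mulmxA -{2}[x]trmxK -trmx_mul mxE.
by apply: sumr_ge0 => i _; rewrite [X in _ * X]mxE -expr2 sqr_ge0.
Qed.

(** The form is nonnegative at [x + a *: y] for every [a], so this quadratic
    polynomial in [a] has a nonpositive discriminant.  The form may be
    degenerate: if [bform M y y = 0] the polynomial is affine, hence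
    constant. *)
Lemma psd_cauchy_schwarz M x y :
  psd M -> bform M x y ^+ 2 <= bform M x x * bform M y y.
Proof.
move=> [Ms Mp].
have H a : 0 <= bform M x x + a * bform M x y *+ 2 + a ^+ 2 * bform M y y.
  have := Mp (x + a *: y).
  rewrite bformDl !bformDr !bformZl !bformZr (bformC y x Ms).
  by congr (0 <= _); ring.
have r0 := Mp y; move: (bform M x x) (bform M x y) (bform M y y) => p q r in H r0 *.
have [r_eq0|r_neq0] := eqVneq r 0.
  rewrite r_eq0 mulr0; have [->|q0] := eqVneq q 0; first by rewrite expr0n.
  (* At this [a] the affine polynomial takes the value [-1]. *)
  have := H (- (p + 1) / (q *+ 2)).
  have -> : - (p + 1) / (q *+ 2) * q *+ 2 = - (p + 1) by field.
  by rewrite r_eq0 mulr0; lra.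
have r_gt0 : 0 < r by rewrite lt_def r_neq0.
have := H (- q / r).
have -> : p + - q / r * q *+ 2 + (- q / r) ^+ 2 * r = (p * r - q ^+ 2) / r by field.
by rewrite pmulr_lge0 ?invr_gt0 // subr_ge0.
Qed.

Lemma bform_delta_l M y i : bform M (delta_mx i 0) y = (M *m y) i 0.
Proof. by rewrite /bform trmx_delta -mulmxA -rowE mxE. Qed.

Lemma bform_delta M i j : bform M (delta_mx i 0) (delta_mx j 0) = M i j.
Proof. by rewrite bform_delta_l -colE mxE. Qed.

Lemma psd_diag_eq0 M i j : psd M -> M i i = 0 -> M i j = 0.
Proof.
move=> Mp Mii; have := psd_cauchy_schwarz (delta_mx i 0) (delta_mx j 0) Mp.
rewrite !bform_delta Mii mul0r => Mij; apply/eqP; rewrite -sqrf_eq0 eq_le Mij.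
exact: sqr_ge0.
Qed.

(** Pivoting: if [M i i] is not zero, subtracting [v v^T], where [v] is column
    [i] divided by the square root of [M i i], keeps the matrix positive
    semidefinite (this is Cauchy-Schwarz with the [i]-th basis vector), clears
    the [i]-th diagonal entry and creates no new nonzero one.  Each step uses a
    new index, so [v] can be stored as column [i] of a square factor. *)
Lemma psd_factor M : psd M -> exists L, M = L *m L^T.
Proof.
suff H k : forall M, psd M -> (#|[pred i | M i i != 0%R]| <= k)%N ->
    exists2 L, M = L *m L^T & forall i, M i i = 0 -> col i L = 0.
  by move=> Mp; have [L -> _] := H _ M Mp (leqnn _); exists L.
elim: k => [|k IHk] {}M Mp cardM;
  have [i /= Mii0|M0] := pickP [pred i | M i i != 0]; try by
    exists 0 => [|i _]; apply/matrixP=> j l; rewrite ?mul0mx !mxE //;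
    apply: psd_diag_eq0 => //; have /negbFE/eqP := M0 j.
  by move: cardM; rewrite leqn0 => /eqP/card0_eq/(_ i); rewrite inE Mii0.
have [Ms Mge0] := Mp.
have Mii : 0 < M i i.
  by rewrite lt_def Mii0 -bform_delta Mge0.
pose v := (Num.sqrt (M i i))^-1 *: col i M.
have vE j l : (v *m v^T) j l = M j i * M i l / M i i.
  rewrite mxE big_ord1 !mxE mulrACA -expr2 exprVn sqr_sqrtr ?ltW //.
  by rewrite mulrC -{2}Ms mxE.
have bvE x : bform (v *m v^T) x x = bform M x (delta_mx i 0) ^+ 2 / M i i.
  rewrite /bform mulmxA -mulmxA -{2}[x]trmxK -trmx_mul mxE big_ord1.
  rewrite [X in _ * X]mxE /v -scalemxAr mxE -expr2 exprMn exprVn sqr_sqrtr ?ltW //.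
  by rewrite colE mulmxA mulrC.
pose M' := M - v *m v^T.
have M'p : psd M'.
  split=> [|x]; first by rewrite linearB /= trmx_mul trmxK Ms.
  rewrite bformB bvE subr_ge0 ler_pdivrMr //.
  by have := psd_cauchy_schwarz x (delta_mx i 0) Mp; rewrite bform_delta.
have M'0 j : M j j = 0 -> M' j j = 0.
  by move=> Mj; rewrite 2!mxE vE Mj (psd_diag_eq0 i Mp Mj) !mul0r subrr.
have M'ii : M' i i = 0 by rewrite 2!mxE vE mulfK // subrr.
have [|L M'E Lcol] := IHk M' M'p.
  rewrite -ltnS; apply: leq_trans cardM; apply: proper_card; apply/properP; split.
    by apply/fintype.subsetP => j; rewrite !inE; apply: contraNN => /eqP/M'0->.
  by exists i; rewrite inE ?Mii0 // M'ii eqxx.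
exists (L + v *m (delta_mx 0 i : 'rV_n)).
  pose e : 'rV[R]_n := delta_mx 0 i; rewrite -/e.
  have LvE : L *m (v *m e)^T = 0.
    by rewrite trmx_mul mulmxA trmx_delta -colE Lcol // mul0mx.
  have vLE : v *m e *m L^T = 0 by rewrite -[v *m e]trmxK -trmx_mul LvE trmx0.
  have eeE : e *m e^T = 1%:M.
    by rewrite trmx_delta mul_delta_mx; apply/matrixP=> j l; rewrite !ord1 !mxE.
  rewrite linearD /= mulmxDl !mulmxDr LvE vLE addr0 add0r trmx_mul mulmxA.
  by rewrite -(mulmxA v e) eeE mulmx1 -M'E subrK.
move=> j Mj; apply/colP=> l; rewrite linearD /= Lcol ?M'0 // add0r.
have ij : i != j by apply: contraNneq Mii0 => ->; apply/eqP.
by rewrite !mxE big_ord1 !mxE (negPf (_ : j != i)) ?mulr0 // eq_sym.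
Qed.

Lemma psd_det_ge0 M : psd M -> 0 <= \det M.
Proof. by move=> /psd_factor[L ->]; rewrite det_mulmx det_tr -expr2 sqr_ge0. Qed.

Lemma psd_unit_det_gt0 M : psd M -> M \in unitmx -> 0 < \det M.
Proof. by move=> Mp; rewrite unitmxE unitfE lt_def psd_det_ge0 // => ->. Qed.

Lemma bform_mulr M1 M2 x y : bform M1 x (M2 *m y) = bform (M1 *m M2) x y.
Proof. by rewrite /bform !mulmxA. Qed.

Lemma bform_mull M1 M2 x y : bform M1 (M2 *m x) y = bform (M2^T *m M1) x y.
Proof. by rewrite /bform trmx_mul !mulmxA. Qed.

Lemma psd_invmx M : psd M -> M \in unitmx -> psd (invmx M).
Proof.
move=> [Ms Mp] Mu; have iMs : (invmx M)^T = invmx M by rewrite trmx_inv Ms.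
split=> // x; have := Mp (invmx M *m x).
by rewrite bform_mulr mulmxV // bform_mull iMs mulmx1.
Qed.

(** Both sides come from two block triangular factorizations of
    [block_mx 1 (- c^T) c M]. *)
Lemma det_rank_one_update M c : M \in unitmx ->
  \det (M + c *m c^T) = \det M * (1 + bform (invmx M) c c).
Proof.
move=> Mu; have := congr1 determinant (_ :
  block_mx 1%:M 0 c 1%:M *m block_mx 1%:M (- c^T) 0 (M + c *m c^T) =
  block_mx (1 + bform (invmx M) c c)%:M (- (c^T *m invmx M)) 0 1%:M
    *m block_mx (1%:M : 'M[R]_1) 0 c M).
rewrite !det_mulmx !det_lblock !det_ublock !det1 !det_scalar1 !mul1r mulr1.
rewrite mulrC; apply.
rewrite !mulmx_block !(mul1mx, mul0mx, mulmx0, mulmx1, addr0, add0r).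
congr block_mx.
- by apply/matrixP => i j; rewrite !ord1 mulNmx [in RHS]mxE [X in _ + X]mxE
    [X in X - _]mxE mulr1n addrK !mxE eqxx.
- by rewrite mulNmx mulmxKV.
- by rewrite mulmxN addrCA addNr addr0.
Qed.

Lemma rank_one_update_unit M c : psd M -> M \in unitmx ->
  M + c *m c^T \in unitmx.
Proof.
move=> Mp Mu; rewrite unitmxE unitfE det_rank_one_update // gt_eqF //.
rewrite mulr_gt0 ?psd_unit_det_gt0 //.
by have [_ /(_ c)] := psd_invmx Mp Mu; lra.
Qed.

(** With [u := Y^-1 c] and [w := X^-1 c], expand the form of [X] at [u - w]:
    [0 <= u^T X u - 2 u^T c + w^T c], and [u^T X u <= u^T Y u = u^T c]. *)
Lemma bform_invmx_anti X Y c : psd X -> X \in unitmx -> Y \in unitmx -> Y^T = Y ->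
  psd (Y - X) -> bform (invmx Y) c c <= bform (invmx X) c c.
Proof.
move=> Xp Xu Yu Ys [_ XY].
have iYs : (invmx Y)^T = invmx Y by rewrite trmx_inv Ys.
have [Xs X0] := Xp; have iXs : (invmx X)^T = invmx X by rewrite trmx_inv Xs.
have := X0 (invmx Y *m c - invmx X *m c); have := XY (invmx Y *m c).
set u := invmx Y *m c; set w := invmx X *m c.
have uYu : bform Y u u = bform (invmx Y) c c.
  by rewrite /u bform_mulr mulmxV // bform_mull mulmx1 iYs.
have vXw v : bform X v w = bform 1%:M v c by rewrite /w bform_mulr mulmxV.
have wXu : bform X w u = bform X u w by exact: bformC.
have uc : bform 1%:M u c = bform (invmx Y) c c by rewrite /u bform_mull mulmx1 iYs.
have wc : bform 1%:M w c = bform (invmx X) c c by rewrite /w bform_mull mulmx1 iXs.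
rewrite bformB uYu -[- w]scaleN1r bformDl !bformDr !bformZl !bformZr.
rewrite wXu !vXw uc wc; lra.
Qed.

(** The columns of a factor of [C] are added one at a time, to [X] and to [Y];
    this does not change [Y - X], so [bform_invmx_anti] compares the factors
    contributed by each column.  The products are cross-multiplied in order to
    avoid quotients. *)
Lemma det_increment_anti X Y C :
  psd X -> X \in unitmx -> psd Y -> Y \in unitmx -> psd (Y - X) -> psd C ->
  \det (Y + C) * \det X <= \det (X + C) * \det Y.
Proof.
move=> Xp Xu Yp Yu XYp /psd_factor[L ->].
have -> : L *m L^T = \sum_(i <- enum 'I_n) col i L *m (col i L)^T.
  rewrite big_enum /=; apply/matrixP => i j; rewrite summxE mxE.
  by apply: eq_bigr => k _; rewrite [RHS]mxE big_ord1 !mxE.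
elim: (enum 'I_n) X Y Xp Xu Yp Yu XYp => [|i s IHs] X Y Xp Xu Yp Yu XYp.
  by rewrite big_nil !addr0 mulrC.
rewrite big_cons; set c := col i L; rewrite !addrA.
have XYc : psd (Y + c *m c^T - (X + c *m c^T)).
  by rewrite opprD addrACA subrr addr0.
have := IHs _ _ (psdD Xp (psd_gram c)) (rank_one_update_unit c Xp Xu)
  (psdD Yp (psd_gram c)) (rank_one_update_unit c Yp Yu) XYc.
rewrite !det_rank_one_update // => H.
have XC0 : 0 <= \det (X + c *m c^T + \sum_(j <- s) col j L *m (col j L)^T).
  apply: psd_det_ge0; apply: psdD; first exact: psdD (psd_gram c).
  by apply: (big_ind psd) => [||j _]; [exact: psd0|exact: psdD|exact: psd_gram].
have a0 : 0 < 1 + bform (invmx X) c c by have [_ /(_ c)] := psd_invmx Xp Xu; lra.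
rewrite -(ler_pM2r a0) -mulrA; apply: le_trans H _.
rewrite -mulrA ler_wpM2l // ler_wpM2l ?psd_det_ge0 //.
by rewrite lerD2l bform_invmx_anti //; case: Yp.
Qed.

End PositiveSemidefinite.

(** * Quadratic Lyapunov functions of stable matrices *)

Section Triangular.
Variables (R : realType) (n : nat).

Lemma uniform_negative_bound (d : 'I_n -> R) : (forall i, d i < 0) ->
  exists2 c : R, 0 < c & forall i, d i <= - c.
Proof.
move=> d0; exists (\big[Num.min/1]_i - d i).
  by apply: lt_bigmin => // i _; rewrite oppr_gt0.
by move=> i; rewrite lerNr; exact: bigmin_le.
Qed.

(** A weighted arithmetic-geometric inequality; the hypothesis on [s ^+ 2] is
    what the weights [s := e ^+ i] and [t := e ^+ j] satisfy when [j < i] and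
    [e <= 1]. *)
Lemma weighted_cross_term (s t r K e a b : R) :
  0 <= s -> 0 <= t -> `|r| <= K -> 0 <= e -> s ^+ 2 <= e * s * t ->
  s ^+ 2 * (r * (a * b)) *+ 2 <= e * K * (s ^+ 2 * a ^+ 2 + t ^+ 2 * b ^+ 2).
Proof.
move=> s0 t0 rK e0 st.
have H1 : s ^+ 2 * (r * (a * b)) <= e * s * t * (K * (`|a| * `|b|)).
  apply: le_trans (_ : s ^+ 2 * (K * (`|a| * `|b|)) <= _).
    rewrite ler_wpM2l ?sqr_ge0 //; apply: le_trans (ler_norm _) _.
    by rewrite normrM normrM ler_wpM2r // mulr_ge0.
  by rewrite ler_wpM2r // !mulr_ge0 // (le_trans _ rK).
rewrite mulr2n; apply: le_trans (lerD H1 H1) _.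
have K0 : 0 <= K by rewrite (le_trans _ rK).
have := mulr_ge0 (mulr_ge0 e0 K0) (sqr_ge0 (s * `|a| - t * `|b|)).
rewrite -[a ^+ 2]real_normK ?num_real // -[b ^+ 2]real_normK ?num_real //.
lra.
Qed.

(** [Tr] and [Ti] are the real and imaginary parts of a complex triangular
    matrix [T], and [p], [q] those of a complex vector [y].  The left-hand sum is
    the real part of the scalar product of [y] and [T y] with weights
    [s i ^+ 2], that is half the derivative of the weighted squared norm along
    [y' = T y].  With [s i := e ^+ i], the term of an entry below the diagonal
    is [O(e)] relative to the weighted norm, so for small [e] the negative
    diagonal wins. *)
Lemma triangular_lyapunov (Tr Ti : 'M[R]_n) :
  (forall i j : 'I_n, (i < j)%N -> Tr i j = 0 /\ Ti i j = 0) ->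
  (forall i, Tr i i < 0) ->
  exists s : 'I_n -> R, exists2 c : R, 0 < c & (forall i, 0 < s i) /\
    forall p q : 'cV[R]_n,
      \sum_i s i ^+ 2 * (p i 0 * (Tr *m p - Ti *m q) i 0
                         + q i 0 * (Tr *m q + Ti *m p) i 0)
      <= - c * \sum_i s i ^+ 2 * (p i 0 ^+ 2 + q i 0 ^+ 2).
Proof.
move=> trig diag_neg.
have [c c0 cP] := uniform_negative_bound diag_neg.
pose K : R := \sum_i \sum_j (`|Tr i j| + `|Ti i j|).
have KP i j : `|Tr i j| <= K /\ `|Ti i j| <= K.
  have H : `|Tr i j| + `|Ti i j| <= K.
    rewrite /K (bigD1 i) //= (bigD1 j) //= -addrA lerDl addr_ge0 //.
      by apply: sumr_ge0 => *; exact: addr_ge0.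
    by apply: sumr_ge0 => k _; apply: sumr_ge0 => *; exact: addr_ge0.
  by split; apply: le_trans H; rewrite ?lerDl ?lerDr.
have K0 : 0 <= K by apply: sumr_ge0 => k _; apply: sumr_ge0 => *; exact: addr_ge0.
have n0 : 0 <= n%:R :> R by [].
(* Off the diagonal each term is at most [e * K * (g i + g j)], in
   total [2 * n * e * K] times the weighted norm; this [e] makes it at most
   half of what the diagonal gives. *)
pose e : R := c / (c + 4 * n%:R * K).
have d0 : 0 < c + 4 * n%:R * K by rewrite ltr_pwDl // !mulr_ge0.
have e0 : 0 < e by rewrite divr_gt0.
have e1 : e <= 1 by rewrite ler_pdivrMr // mul1r lerDl !mulr_ge0.
have eK : 4 * n%:R * (e * K) <= c.
  have : e * (c + 4 * n%:R * K) = c by rewrite divfK // gt_eqF.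
  have : 0 <= e * c by rewrite mulr_ge0 // ltW.
  lra.
exists (fun i : 'I_n => e ^+ i), (c / 2); first by rewrite divr_gt0.
split=> [i|p q]; first exact: exprn_gt0.
pose g (i : 'I_n) := (e ^+ i) ^+ 2 * (p i 0 ^+ 2 + q i 0 ^+ 2).
have g0 i : 0 <= g i by rewrite mulr_ge0 ?addr_ge0 ?sqr_ge0.
rewrite -[\sum_i (e ^+ _) ^+ 2 * (p _ _ ^+ 2 + _)]/(\sum_i g i).
pose h i j := (if j == i then - c * g i else 0) + e * K * (g i + g j).
apply: le_trans (_ : \sum_i \sum_j h i j <= _).
  apply: ler_sum => i _.
  apply: le_trans (_ : \sum_j (e ^+ i) ^+ 2 * (
      Tr i j * (p i 0 * p j 0) + Ti i j * (- p i 0 * q j 0)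
      + (Tr i j * (q i 0 * q j 0) + Ti i j * (q i 0 * p j 0))) <= _).
    rewrite !mxE -sumrB -big_split /= !mulr_sumr -big_split /= mulr_sumr.
    by rewrite le_eqVlt; apply/orP; left; apply/eqP; apply: eq_bigr => j _; ring.
  apply: ler_sum => j _; rewrite /h.
  have eKg : 0 <= e * K * (g i + g j).
    by rewrite mulr_ge0 ?addr_ge0 // mulr_ge0 // ltW.
  move: eKg; have [->|ij {}eKg] := eqVneq j i.
    have := ler_wpM2l (g0 i) (cP i); rewrite /g; move: (e ^+ i) => ei; lra.
  have [ltij|ltji|/val_inj eij] := ltngtP i j; last by rewrite eij eqxx in ij.
    by have [-> ->] := trig i j ltij; rewrite !mul0r !addr0 mulr0 add0r.
  have est : (e ^+ i) ^+ 2 <= e * e ^+ i * e ^+ j.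
    rewrite expr2 mulrAC ler_wpM2r ?(exprn_ge0 _ (ltW e0)) // -exprS.
    by apply: ler_wiXn2l => //; exact: ltW.
  have [KTr KTi] := KP i j.
  have ei : 0 <= e ^+ i by rewrite exprn_ge0 // ltW.
  have ej : 0 <= e ^+ j by rewrite exprn_ge0 // ltW.
  have C r a b rK := @weighted_cross_term _ _ r K e a b ei ej rK (ltW e0) est.
  have := C _ (p i 0) (p j 0) KTr; have := C _ (- p i 0) (q j 0) KTi.
  have := C _ (q i 0) (q j 0) KTr; have := C _ (q i 0) (p j 0) KTi.
  rewrite /g; move: (e ^+ i) (e ^+ j) => si sj; lra.
have hE i : \sum_j h i j = - c * g i + e * K * (n%:R * g i + \sum_j g j).
  rewrite big_split /= -big_mkcond big_pred1_eq -mulr_sumr big_split /=.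
  by rewrite sumr_const card_ord mulr_natl.
rewrite (eq_bigr _ (fun i _ => hE i)) big_split /= -!mulr_sumr big_split /=.
rewrite sumr_const card_ord -mulr_sumr -(mulr_natl (\sum_i g i)).
have G0 : 0 <= \sum_i g i by exact: sumr_ge0.
have := ler_wpM2r G0 eK; lra.
Qed.

End Triangular.

Section Lyapunov.
Variable R : realType.

Local Notation ReM := (map_mx (@complex.Re R)).
Local Notation ImM := (map_mx (@complex.Im R)).
Local Notation CM := (map_mx (real_complex R)).

Lemma Re_sum (I : finType) (F : I -> R[i]) :
  complex.Re (\sum_i F i) = \sum_i complex.Re (F i).
Proof. by apply: (big_morph (@complex.Re R)) => // -[? ?] [? ?]. Qed.

Lemma Im_sum (I : finType) (F : I -> R[i]) :
  complex.Im (\sum_i F i) = \sum_i complex.Im (F i).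
Proof. by apply: (big_morph (@complex.Im R)) => // -[? ?] [? ?]. Qed.

Lemma Re_mulmx (m n p : nat) (M : 'M[R[i]]_(m, n)) (N : 'M[R[i]]_(n, p)) :
  ReM (M *m N) = ReM M *m ReM N - ImM M *m ImM N.
Proof.
apply/matrixP => i j; rewrite !mxE Re_sum -sumrB; apply: eq_bigr => k _.
by rewrite !mxE; case: (M i k) (N k j) => ? ? [].
Qed.

Lemma Im_mulmx (m n p : nat) (M : 'M[R[i]]_(m, n)) (N : 'M[R[i]]_(n, p)) :
  ImM (M *m N) = ReM M *m ImM N + ImM M *m ReM N.
Proof.
apply/matrixP => i j; rewrite !mxE Im_sum -big_split; apply: eq_bigr => k _.
by rewrite !mxE; case: (M i k) (N k j) => ? ? [].
Qed.

Lemma Re_CM (m n : nat) (M : 'M[R]_(m, n)) : ReM (CM M) = M.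
Proof. by apply/matrixP => i j; rewrite !mxE. Qed.

Lemma Im_CM (m n : nat) (M : 'M[R]_(m, n)) : ImM (CM M) = 0.
Proof. by apply/matrixP => i j; rewrite !mxE. Qed.

Lemma ReIm_mx_eq0 (m n : nat) (M : 'M[R[i]]_(m, n)) :
  ReM M = 0 -> ImM M = 0 -> M = 0.
Proof.
move=> /matrixP Re0 /matrixP Im0; apply/matrixP => i j.
by have := Re0 i j; have := Im0 i j; rewrite !mxE; case: (M i j) => a b /= -> ->.
Qed.

(** Unitary triangularization needs no hypothesis on [A]; the diagonal of the
    triangular form consists of eigenvalues of [A], where stability applies. *)
Lemma stable_triangularization (n : nat) (A : 'M[R]_n) : stable_matrix A ->
  exists U T : 'M[R[i]]_n, [/\ U \in unitmx, U *m CM A = T *m U,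
    forall i j : 'I_n, (i < j)%N -> T i j = 0 &
    forall i, complex.Re (T i i) < 0].
Proof.
move=> As.
(* [A] commutes with itself: simultaneous triangularization also covers
   [n = 0]. *)
have [U /unitarymx_unit Uu /andP[UT _]] :=
  cotrigonalization2 (erefl (CM A *m CM A)).
have stab : stablemx U (CM A) by exact: stablemx_unit.
have Ufree : row_free U by rewrite row_free_unit.
exists U, (conjmx U (CM A)); split => //.
- by rewrite conjumx // mulmxKV.
- exact/is_trig_mxP.
- move=> i; apply: As; apply: (eigenvalue_conjmx stab Ufree).
  rewrite -topredE /= eigenvalue_root_char char_poly_trig // rootE horner_prod.
  by rewrite (bigD1 i) //= hornerXsubC subrr mul0r.
Qed.

(** [P] is the real part of [U^* D U], with [U] a triangularizing matrix and [D]
    the diagonal matrix of the weights of [triangular_lyapunov]: the form of [P]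
    at a real [x] is the weighted squared norm of [U x], which vanishes only at
    [x = 0] because [U] is invertible. *)
Lemma lyapunov (n : nat) (A : 'M[R]_n) : stable_matrix A ->
  exists P : 'M[R]_n, exists2 c : R, 0 < c & [/\ psd P, P \in unitmx &
    forall x : 'cV[R]_n, bform P x (A *m x) <= - c * bform P x x].
Proof.
move=> /stable_triangularization[U [T [Uu UA trig neg]]].
have [||s [c c0 [s0 sP]]] := @triangular_lyapunov R n (ReM T) (ImM T).
- by move=> i j ij; rewrite !mxE trig.
- by move=> i; rewrite mxE.
pose S := diag_mx (\row_i s i).
pose L1 := S *m ReM U; pose L2 := S *m ImM U.
pose P := L1^T *m L1 + L2^T *m L2.
have Pp : psd P.
  have gram (L : 'M[R]_n) : psd (L^T *m L).
    by have := psd_gram L^T; rewrite trmxK.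
  exact: psdD.
have SE (M : 'M[R]_n) (x : 'cV[R]_n) i : (S *m M *m x) i 0 = s i * (M *m x) i 0.
  by rewrite -mulmxA mul_diag_mx !mxE.
have PE x y : bform P x y = \sum_i s i ^+ 2 *
    ((ReM U *m x) i 0 * (ReM U *m y) i 0 + (ImM U *m x) i 0 * (ImM U *m y) i 0).
  have E (L : 'M[R]_n) :
      bform (L^T *m L) x y = \sum_i (L *m x) i 0 * (L *m y) i 0.
    rewrite /bform mulmxA -trmx_mul -mulmxA mxE.
    by apply: eq_bigr => i _; rewrite mxE.
  rewrite bformD !E -big_split; apply: eq_bigr => i _ /=; rewrite !SE; ring.
have Pu : P \in unitmx.
  rewrite unitmxE unitfE; apply/det0P => -[v /negP v0 vP]; apply: v0.
  have := PE v^T v^T; rewrite /bform trmxK vP mul0mx mxE => /esym/eqP.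
  have F i : true -> 0 <= s i ^+ 2 * ((ReM U *m v^T) i 0 * (ReM U *m v^T) i 0
      + (ImM U *m v^T) i 0 * (ImM U *m v^T) i 0).
    by move=> _; rewrite -!expr2 mulr_ge0 ?addr_ge0 ?sqr_ge0.
  rewrite psumr_eq0 // => /allP Z.
  have Z12 i : (ReM U *m v^T) i 0 = 0 /\ (ImM U *m v^T) i 0 = 0.
    have := Z i (mem_index_enum i).
    rewrite mulf_eq0 sqrf_eq0 (gt_eqF (s0 i)) /= -!expr2 paddr_eq0 ?sqr_ge0 //.
    by rewrite !sqrf_eq0 => /andP[/eqP -> /eqP ->].
  have Uv : U *m CM v^T = 0.
    apply: ReIm_mx_eq0.
      rewrite Re_mulmx Re_CM Im_CM mulmx0 subr0.
      by apply/colP => i; rewrite (Z12 i).1 mxE.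
    rewrite Im_mulmx Re_CM Im_CM mulmx0 add0r.
    by apply/colP => i; rewrite (Z12 i).2 mxE.
  have : CM v^T = 0 by rewrite -(mulKmx Uu (CM v^T)) Uv mulmx0.
  move=> /(congr1 ReM); rewrite Re_CM => /(congr1 trmx); rewrite trmxK => ->.
  by apply/eqP/rowP => i; rewrite !mxE.
exists P, c => //; split=> // x; rewrite !PE.
have UrA : ReM U *m A = ReM T *m ReM U - ImM T *m ImM U.
  by rewrite -Re_mulmx -UA Re_mulmx Re_CM Im_CM mulmx0 subr0.
have UiA : ImM U *m A = ReM T *m ImM U + ImM T *m ReM U.
  by rewrite -Im_mulmx -UA Im_mulmx Re_CM Im_CM mulmx0 add0r.
have := sP (ReM U *m x) (ImM U *m x).
by rewrite !mulmxA UrA UiA mulmxBl mulmxDl.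
Qed.

End Lyapunov.

(** * The matrix exponential *)

Section Exponential.
Variables (R : realType) (n : nat).
Implicit Types (A M : 'M[R]_n) (t : R).

Lemma cvg_mx_entrywise (m p : nat) (F : nat -> 'M[R]_(m, p)) (L : 'M[R]_(m, p)) :
  (forall i j, F k i j @[k --> \oo] --> L i j) -> F k @[k --> \oo] --> L.
Proof.
move=> FL; apply/cvg_ballP => e e0.
have H : \forall k \near \oo, forall i j, ball (L i j) e (F k i j).
  apply: filter_forall => i; apply: filter_forall => j.
  by have /cvg_ballP/(_ e e0) := FL i j.
by apply: filterS H => k Fk; split.
Qed.

(** The coefficients of the power series in [t] of the entries of
    [M *m expmx (t *: A)].  The factor [M] makes the family closed under
    differentiation, which replaces [M] by [M *m A]. *)
Definition exp_coef A M (i j : 'I_n) : R^nat :=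
  fun k => (M *m A ^+ k) i j / k`!%:R.

Lemma exp_coef_diffs A M i j :
  pseries_diffs (exp_coef A M i j) = exp_coef A (M *m A) i j.
Proof.
apply/funext => k; rewrite /pseries_diffs /exp_coef exprS -mulmxA factS natrM.
by rewrite invfM mulrCA mulVKf // pnatr_eq0.
Qed.

Lemma pow_entry_bound A :
  exists2 K, 0 <= K & forall M, exists2 C, 0 <= C &
    forall i j k, `|(M *m A ^+ k) i j| <= C * K ^+ k.
Proof.
pose N M := \sum_i \sum_j `|M i j|.
have N0 M : 0 <= N M by apply: sumr_ge0 => *; apply: sumr_ge0.
have Nrow M i : \sum_j `|M i j| <= N M.
  by rewrite /N [leRHS](bigD1 i) //= lerDl; apply: sumr_ge0 => *; apply: sumr_ge0.
have NE M i j : `|M i j| <= N M.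
  by apply: le_trans (Nrow M i); rewrite (bigD1 j) //= lerDl; apply: sumr_ge0.
exists (N A) => // M; exists (N M) => // i j k.
have Ak l : `|(A ^+ k) l j| <= N A ^+ k.
  elim: k l => [|k IHk] l; first by rewrite !expr0 mxE normr_nat; case: eqP.
  rewrite !exprS mxE; apply: le_trans (ler_norm_sum _ _ _) _.
  apply: le_trans (_ : \sum_h `|A l h| * N A ^+ k <= _).
    by apply: ler_sum => h _; rewrite normrM ler_wpM2l.
  by rewrite -mulr_suml ler_wpM2r // exprn_ge0.
rewrite mxE; apply: le_trans (ler_norm_sum _ _ _) _.
apply: le_trans (_ : \sum_h `|M i h| * N A ^+ k <= _).
  by apply: ler_sum => h _; rewrite normrM ler_wpM2l.
by rewrite -mulr_suml ler_wpM2r // exprn_ge0.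
Qed.

Lemma is_cvg_pseries_exp_coef A M i j t : cvgn (pseries (exp_coef A M i j) t).
Proof.
have [K K0 /(_ M)[C C0 MC]] := pow_entry_bound A.
apply: normed_cvg; apply: (@series_le_cvg _ _ (C *: exp_coeff (K * `|t|))).
- by move=> k; exact: normr_ge0.
- by move=> k; rewrite mulr_ge0 // divr_ge0 // exprn_ge0 // mulr_ge0.
- move=> k; rewrite /exp_coef /exp_coeff /= !normrM normrX normfV normr_nat.
  rewrite [leRHS](_ : _ = C * K ^+ k / k`!%:R * `|t| ^+ k); last first.
    by rewrite -[LHS]/(C * ((K * `|t|) ^+ k / k`!%:R)) exprMn; ring.
  by rewrite ler_wpM2r ?exprn_ge0 // ler_wpM2r // invr_ge0.
- by apply: is_cvg_seriesZ; exact: is_cvg_series_exp_coeff.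
Qed.

Lemma cvg_expmx A t :
  series (fun k => (k`!%:R)^-1 *: (t *: A) ^+ k) k @[k --> \oo]
    --> \matrix_(i, j) limn (pseries (exp_coef A 1%:M i j) t).
Proof.
apply: cvg_mx_entrywise => i j; rewrite mxE.
rewrite (_ : (fun k => _) = pseries (exp_coef A 1%:M i j) t).
  exact: is_cvg_pseries_exp_coef.
apply/funext => N; rewrite /pseries /series /= summxE; apply: eq_bigr => k _.
have -> : (t *: A) ^+ k = t ^+ k *: A ^+ k.
  elim: k => [|k IHk]; first by rewrite !expr0 scale1r.
  by rewrite !exprS IHk -!mulmxE -scalemxAl -scalemxAr scalerA.
rewrite !mxE /exp_coef mul1mx; ring.
Qed.

Lemma expmxE A t i j :
  expmx (t *: A) i j = limn (pseries (exp_coef A 1%:M i j) t).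
Proof.
by rewrite /expmx (cvg_lim _ (@cvg_expmx A t)) ?mxE //; exact: norm_hausdorff.
Qed.

Lemma expmx_tr A t : expmx (t *: A^T) = (expmx (t *: A))^T.
Proof.
apply/matrixP => i j; rewrite mxE !expmxE; congr (limn (pseries _ t)).
apply/funext => k; rewrite /exp_coef !mul1mx.
have -> : A^T ^+ k = (A ^+ k)^T; last by rewrite mxE.
elim: k => [|k IHk]; first by rewrite !expr0 trmx1.
by rewrite exprSr exprS IHk -!mulmxE trmx_mul.
Qed.

Lemma mulmx_expmx A M t i j :
  (M *m expmx (t *: A)) i j = limn (pseries (exp_coef A M i j) t).
Proof.
apply/esym/cvg_lim; first exact: Rhausdorff.
rewrite mxE (_ : pseries _ _ = fun N =>
    \sum_l M i l * pseries (exp_coef A 1%:M l j) t N).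
  apply: cvg_big; first exact: add_continuous.
  by move=> l _; rewrite expmxE; apply: cvgMr; exact: is_cvg_pseries_exp_coef.
apply/funext => N; rewrite /pseries /series /=.
under [RHS]eq_bigr do rewrite mulr_sumr.
rewrite exchange_big /=; apply: eq_bigr => k _.
rewrite /exp_coef mxE !mulr_suml; apply: eq_bigr => l _.
by rewrite mul1mx !mulrA.
Qed.

Lemma is_derive_expmx A t i j :
  is_derive t (1 : R) (fun t => expmx (t *: A) i j) ((A *m expmx (t *: A)) i j).
Proof.
rewrite mulmx_expmx (_ : (fun t => _) =
    fun t => limn (pseries (exp_coef A 1%:M i j) t)); last first.
  by apply/funext => s; exact: expmxE.
have -> : exp_coef A A i j = pseries_diffs (exp_coef A 1%:M i j).
  by rewrite exp_coef_diffs mul1mx.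
apply: (@pseries_snd_diffs _ _ (`|t| + 1));
  rewrite ?exp_coef_diffs; try exact: is_cvg_pseries_exp_coef.
by rewrite [ltRHS]ger0_norm ?addr_ge0 // ltrDl.
Qed.

Lemma is_derive_bform (P : 'M[R]_n) (x : R -> 'cV[R]_n) (dx : 'cV[R]_n) t :
  P^T = P -> (forall i, is_derive t (1 : R) (fun s => x s i 0) (dx i 0)) ->
  is_derive t (1 : R) (fun s => bform P (x s) (x s)) (2 * bform P (x t) dx).
Proof.
move=> Ps xd.
have bE y z : bform P y z = \sum_i \sum_j y i 0 * (P i j * z j 0).
  rewrite /bform -mulmxA mxE; apply: eq_bigr => i _; rewrite !mxE mulr_sumr.
  by apply: eq_bigr.
rewrite (_ : (fun s => _) =
    \sum_i \sum_j (fun s => x s i 0 * (P i j * x s j 0))); last first.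
  apply/funext => s; rewrite bE !fct_sumE; apply: eq_bigr => i _.
  by rewrite fct_sumE.
rewrite (_ : 2 * _ = \sum_i \sum_j
    (dx i 0 * (P i j * x t j 0) + x t i 0 * (P i j * dx j 0))).
  apply: is_derive_sum => i; apply: is_derive_sum => j.
  have ? := xd i; have ? := xd j.
  by apply: is_derive_eq; rewrite /GRing.scale /=; ring.
rewrite mulr_natl mulr2n {1}(bformC _ _ Ps) !bE -big_split /=.
by apply: eq_bigr => i _; rewrite -big_split.
Qed.

End Exponential.

(** * Exponential decay and integrability *)

Section Decay.
Variables (R : realType) (n : nat).
Implicit Types (A M : 'M[R]_n) (t : R).

(** The derivative of [expR (c * t) * q t] is nonpositive. *)
Lemma gronwall_decay (q dq : R -> R) (c : R) :
  (forall t, is_derive t (1 : R) q (dq t)) -> (forall t, dq t <= - c * q t) ->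
  forall t, 0 <= t -> q t <= q 0 * expR (- c * t).
Proof.
move=> qd qle t t0.
pose h := fun s : R => expR (c * s) * q s.
have hd s : is_derive s (1 : R) h (expR (c * s) * (dq s + c * q s)).
  have ? := qd s; apply: is_derive_eq; rewrite /GRing.scale /=; ring.
have : h t <= h 0.
  apply: (@ler0_derive1_nincry _ h 0) => //.
  - move=> s _; rewrite derive1E (@derive_val _ _ _ _ _ _ _ (hd s)).
    rewrite mulr_ge0_le0 ?expR_ge0 //.
    by have := qle s; lra.
  - by apply: derivable_within_continuous => s _; case: (hd s).
rewrite /h mulr0 expR0 mul1r => H.
by rewrite mulNr expRN ler_pdivlMr ?expR_gt0 // mulrC.
Qed.

(** The columns of [expmx (t *: A)] are trajectories of [x' = A x], along which
    the Lyapunov form decays.  It controls each coordinate of [x], since the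
    [i]-th one is the form of [P] at [P^-1 e_i] and [x], to which Cauchy-Schwarz
    applies. *)
Lemma expmx_decay A : stable_matrix A ->
  exists2 c : R, 0 < c & exists K : R, forall t, 0 <= t ->
    forall i j, `|expmx (t *: A) i j| <= K * expR (- c * t).
Proof.
move=> /lyapunov[P [c c0 [Pp Pu Pc]]]; have [Ps P0] := Pp.
pose x (j : 'I_n) t := col j (expmx (t *: A)).
pose q j t := bform P (x j t) (x j t).
have qdecay j t : 0 <= t -> q j t <= q j 0 * expR (- (2 * c) * t).
  apply: (@gronwall_decay (q j) (fun s => 2 * bform P (x j s) (A *m x j s))).
    move=> s; apply: is_derive_bform => // i.
    rewrite [x j s]colE mulmxA -colE mxE.
    rewrite (_ : (fun s => _) = (fun s => expmx (s *: A) i j)).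
      exact: is_derive_expmx.
    by apply/funext => r; rewrite mxE.
  by move=> s; have := Pc (x j s); rewrite -/(q j s); lra.
pose u (i : 'I_n) : 'cV[R]_n := invmx P *m delta_mx i 0.
pose k i j := Num.sqrt (bform P (u i) (u i) * q j 0).
exists c => //; exists (\sum_i \sum_j k i j) => t t0 i j.
apply: le_trans (_ : k i j * expR (- c * t) <= _); last first.
  rewrite ler_wpM2r ?expR_ge0 // (bigD1 i) //= (bigD1 j) //= -addrA lerDl.
  by rewrite addr_ge0 //; repeat (apply: sumr_ge0 => ? _); exact: sqrtr_ge0.
rewrite -(@ler_pXn2r _ 2) ?nnegrE ?mulr_ge0 ?sqrtr_ge0 ?expR_ge0 //.
rewrite exprMn sqr_sqrtr ?mulr_ge0 //; try exact: P0.
rewrite real_normK ?num_real // -expRM_natl.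
have -> : expmx (t *: A) i j = bform P (u i) (x j t).
  rewrite /u bform_mull trmx_inv Ps mulVmx // /bform mulmx1 trmx_delta.
  by rewrite -rowE !mxE.
apply: le_trans (psd_cauchy_schwarz _ _ Pp) _.
rewrite -mulrA ler_wpM2l //.
by apply: le_trans (qdecay j t t0) _; rewrite mulrA mulrN.
Qed.

End Decay.

Section Integrals.
Variable R : realType.
Local Notation mu := (@lebesgue_measure R).
Local Notation D := (`[(0 : R), +oo[%classic).

Lemma integrable_expR_decay (c : R) : 0 < c ->
  mu.-integrable D (EFin \o (fun t => expR (- c * t))).
Proof.
move=> c0; have mD := measurable_itv `[(0 : R), +oo[.
have := @integrableZl _ _ _ mu _ mD c^-1 _
  (@integrableS _ _ _ mu _ _ _ measurableT mD (@subsetT _ _)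
     (integrable_exponential_pdf c0)).
apply: eq_integrable => // t; rewrite inE /= in_itv /= andbT => t0.
by rewrite exponential_pdfE // -EFinM mulKf // gt_eqF.
Qed.

Lemma integrable_of_decay (f : R -> R) (c K : R) : 0 < c -> continuous f ->
  (forall t, 0 <= t -> `|f t| <= K * expR (- c * t)) ->
  mu.-integrable D (EFin \o f).
Proof.
move=> c0 fc fK.
have := @integrableZl _ _ _ mu _ (measurable_itv _) K _ (integrable_expR_decay c0).
apply: le_integrable => //.
  apply/measurable_realfun.measurable_EFinP; apply: measurable_funTS.
  exact: measurable_realfun.continuous_measurable_fun.
move=> t; rewrite /= in_itv /= andbT => t0; rewrite lee_fin.
by apply: le_trans (fK t t0) _; exact: ler_norm.
Qed.

(** Real-valued integrals are additive only on integrable functions; carrying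
    integrability together with the value lets linear combinations of integrals
    be formed without side conditions. *)
Definition has_integral (f : R -> R) (v : R) : Prop :=
  mu.-integrable D (EFin \o f) /\ \int[mu]_(t in D) f t = v.

Lemma has_integralD f g u v : has_integral f u -> has_integral g v ->
  has_integral (fun t => f t + g t) (u + v).
Proof.
move=> [fi <-] [gi <-]; split; last by rewrite RintegralD.
have := @integrableD _ _ _ mu _ (measurable_itv _) _ _ fi gi.
exact: eq_integrable.
Qed.

Lemma has_integralZ f v a : has_integral f v ->
  has_integral (fun t => a * f t) (a * v).
Proof.
move=> [fi <-]; split; last by rewrite RintegralZl.
have := @integrableZl _ _ _ mu _ (measurable_itv _) a _ fi.
exact: eq_integrable.
Qed.

Lemma has_integral0 : has_integral (fun=> 0) 0.
Proof. by split; [exact: integrable0|rewrite Rintegral_cst // mul0r]. Qed.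

Lemma has_integral_sum (I : finType) (f : I -> R -> R) (v : I -> R) :
  (forall i, has_integral (f i) (v i)) ->
  has_integral (fun t => \sum_i f i t) (\sum_i v i).
Proof.
move=> fv; elim: (index_enum I) => [|i s IHs].
  rewrite big_nil (_ : (fun t => _) = fun=> 0); first exact: has_integral0.
  by apply/funext => t; rewrite big_nil.
rewrite big_cons (_ : (fun t => _) = fun t => f i t + \sum_(j <- s) f j t).
  exact: has_integralD.
by apply/funext => t; rewrite big_cons.
Qed.

Lemma has_integral_sum2 (I J : finType) (f : I -> J -> R -> R) (v : I -> J -> R) :
  (forall i j, has_integral (f i j) (v i j)) ->
  has_integral (fun t => \sum_i \sum_j f i j t) (\sum_i \sum_j v i j).
Proof.
move=> fv; apply: (@has_integral_sum _ (fun i t => \sum_j f i j t)) => i.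
exact: has_integral_sum.
Qed.

End Integrals.

(** * The Gramian as a linear map of [B B^T] *)

Section Gramian.
Variables (R : realType) (n : nat) (A : 'M[R]_n).
Hypothesis A_stable : stable_matrix A.
Local Notation mu := (@lebesgue_measure R).
Local Notation D := (`[(0 : R), +oo[%classic).
Implicit Types (M : 'M[R]_n).

Definition gram_integrand M (t : R) : 'M[R]_n :=
  expmx (t *: A) *m M *m (expmx (t *: A))^T.

Definition gram_map M : 'M[R]_n :=
  \matrix_(i, j) \int[mu]_(t in D) gram_integrand M t i j.

Lemma gramianE (p : nat) (B : 'M[R]_(n, p)) : gramian A B = gram_map (B *m B^T).
Proof.
apply/matrixP => i j; rewrite !mxE; apply: eq_Rintegral => t _.
by rewrite /gram_integrand expmx_tr !mulmxA.
Qed.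

Lemma gram_integrandE M t i j : gram_integrand M t i j =
  \sum_k \sum_l M k l * (expmx (t *: A) i k * expmx (t *: A) j l).
Proof.
rewrite /gram_integrand mxE exchange_big /=; apply: eq_bigr => l _.
rewrite !mxE mulr_suml; apply: eq_bigr => k _; ring.
Qed.

(** An entry is a combination of products of two entries of [expmx (t *: A)],
    each of which decays exponentially. *)
Lemma has_integral_gram M i j :
  has_integral (fun t => gram_integrand M t i j) (gram_map M i j).
Proof.
suff [v fv] : exists v, has_integral (fun t => gram_integrand M t i j) v.
  by split; [exact: fv.1|rewrite mxE].
have [c c0 [K KP]] := expmx_decay A_stable.
have prod_int k l : has_integral
    (fun t => expmx (t *: A) i k * expmx (t *: A) j l)
    (\int[mu]_(t in D) (expmx (t *: A) i k * expmx (t *: A) j l)).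
  split => //; apply: (@integrable_of_decay _ _ (c + c) (K * K)).
  - exact: addr_gt0.
  - move=> t; apply: differentiable_continuous; apply/derivable1_diffP.
    by apply: derivableM;
      [case: (is_derive_expmx A t i k)|case: (is_derive_expmx A t j l)].
  - move=> t t0; rewrite normrM opprD mulrDl expRD mulrACA.
    by apply: ler_pM => //; exact: KP.
exists (\sum_k \sum_l M k l *
  \int[mu]_(t in D) (expmx (t *: A) i k * expmx (t *: A) j l)).
rewrite (_ : (fun t => _) = fun t =>
  \sum_k \sum_l M k l * (expmx (t *: A) i k * expmx (t *: A) j l)); last first.
  by apply/funext => t; exact: gram_integrandE.
apply: has_integral_sum2 => k l.
exact: has_integralZ.
Qed.

Lemma gram_mapD M N : gram_map (M + N) = gram_map M + gram_map N.
Proof.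
apply/matrixP => i j; rewrite [RHS]mxE.
have [_ <-] := has_integralD (has_integral_gram M i j) (has_integral_gram N i j).
rewrite mxE; apply: eq_Rintegral => t _.
by rewrite /gram_integrand mulmxDr mulmxDl mxE.
Qed.

Lemma gram_map0 : gram_map 0 = 0.
Proof.
by have /eqP := gram_mapD 0 0; rewrite addr0 eq_sym -subr_eq0 addrK => /eqP.
Qed.

(** The form of [gram_map M] at [x] is the integral of the form of [M] at
    [(expmx (t *: A))^T *m x]. *)
Lemma gram_map_psd M : psd M -> psd (gram_map M).
Proof.
move=> [Ms M0]; split=> [|x].
  apply/matrixP => i j; rewrite !mxE; apply: eq_Rintegral => t _.
  suff gs : (gram_integrand M t)^T = gram_integrand M t by rewrite -{1}gs mxE.
  by rewrite /gram_integrand !trmx_mul trmxK Ms mulmxA.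
have bE N (y : 'cV[R]_n) : bform N y y = \sum_i \sum_j y i 0 * y j 0 * N i j.
  rewrite /bform -mulmxA mxE; apply: eq_bigr => i _; rewrite !mxE mulr_sumr.
  by apply: eq_bigr => j _; ring.
rewrite bE.
have [_ <-] : has_integral (fun t => bform (gram_integrand M t) x x)
    (\sum_i \sum_j x i 0 * x j 0 * gram_map M i j).
  rewrite (_ : (fun t => _) = fun t =>
    \sum_i \sum_j x i 0 * x j 0 * gram_integrand M t i j); last first.
    by apply/funext => t; rewrite bE.
  apply: has_integral_sum2 => i j.
  exact: has_integralZ (has_integral_gram M i j).
apply: Rintegral_ge0 => t _.
by have := M0 ((expmx (t *: A))^T *m x);
  rewrite bform_mulr bform_mull trmxK mulmxA.
Qed.

End Gramian.

Lemma input_matrix_gram (R : realType) (n m M : nat) (B0 : 'M[R]_(n, m))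
    (b : 'I_M -> 'cV[R]_n) (S : {set 'I_M}) :
  input_matrix B0 b S *m (input_matrix B0 b S)^T
  = B0 *m B0^T + \sum_(s in S) b s *m (b s)^T.
Proof.
rewrite /input_matrix tr_row_mx mul_row_col; congr (_ + _).
rewrite big_enum_val /=; apply/matrixP => i j; rewrite summxE mxE.
by apply: eq_bigr => k _; rewrite !mxE big_ord1 !mxE.
Qed.

Lemma gramian_input (R : realType) (n m M : nat) (A : 'M[R]_n)
    (B0 : 'M[R]_(n, m)) (b : 'I_M -> 'cV[R]_n) (S : {set 'I_M}) :
  stable_matrix A ->
  gramian A (input_matrix B0 b S)
  = gramian A B0 + \sum_(s in S) gramian A (b s).
Proof.
move=> As; rewrite !gramianE input_matrix_gram gram_mapD //; congr (_ + _).
rewrite (big_morph _ (gram_mapD As) (gram_map0 As)).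
by apply: eq_bigr => s _; rewrite gramianE.
Qed.

Lemma gramian_psd (R : realType) (n p : nat) (A : 'M[R]_n) (B : 'M[R]_(n, p)) :
  stable_matrix A -> psd (gramian A B).
Proof.
by move=> As; rewrite gramianE; apply: gram_map_psd => //; exact: psd_gram.
Qed.

(** * Submodularity *)

(** Adding [a] to [S] adds [G a] to the matrix whatever [S] is, so the two
    increments to compare are those of [det_increment_anti] for the same [C]. *)
Lemma submodular_ln_det_sum (R : realType) (n : nat) (T : finType)
    (G0 : 'M[R]_n) (G : T -> 'M[R]_n) :
  psd G0 -> (forall t, psd (G t)) ->
  (forall S : {set T}, G0 + \sum_(s in S) G s \in unitmx) ->
  submodular (fun S : {set T} => ln (\det (G0 + \sum_(s in S) G s))).
Proof.
move=> G0p Gp G_unit X Y a XY aY; have aX := contra (fintype.subsetP XY a) aY.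
pose W (S : {set T}) := G0 + \sum_(s in S) G s.
have Wp S : psd (W S) by apply: psdD => //; exact: psd_sum.
have Wpos S : 0 < \det (W S) := psd_unit_det_gt0 (Wp S) (G_unit S).
have WU (S : {set T}) : a \notin S -> W (a |: S) = W S + G a.
  by move=> aS; rewrite /W big_setU1 //= addrCA addrC.
have WYX : psd (W Y - W X).
  rewrite /W (big_setID X) /= (finset.setIidPr XY) opprD addrACA subrr add0r.
  by rewrite addrAC subrr add0r; exact: psd_sum.
have det_le : \det (W (a |: Y)) * \det (W X) <= \det (W (a |: X)) * \det (W Y).
  rewrite (WU X aX) (WU Y aY).
  exact: (det_increment_anti (Wp X) (G_unit X) (Wp Y) (G_unit Y) WYX (Gp a)).
rewrite -/(W (a |: X)) -/(W X) -/(W (a |: Y)) -/(W Y) lerBrDr addrAC lerBlDr.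
by rewrite -!lnM ?posrE // ler_ln // posrE mulr_gt0.
Qed.

Theorem theorem3 (R : realType) (n m M : nat) (A : 'M[R]_n)
    (B0 : 'M[R]_(n, m)) (b : 'I_M -> 'cV[R]_n)
    (A_stable : stable_matrix A)
    (W_inv : forall S : {set 'I_M}, gramian A (input_matrix B0 b S) \in unitmx) :
  submodular (fun S : {set 'I_M} => ln (\det (gramian A (input_matrix B0 b S)))).
Proof.
have WE (S : {set 'I_M}) : gramian A (input_matrix B0 b S)
    = gramian A B0 + \sum_(s in S) gramian A (b s) by exact: gramian_input.
rewrite (_ : (fun S : {set 'I_M} => _) =
    fun S : {set 'I_M} => ln (\det (gramian A B0 + \sum_(s in S) gramian A (b s)))).
  apply: submodular_ln_det_sum => [|s|S]; try exact: gramian_psd.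
  by rewrite -WE.
by apply/funext => S; rewrite WE.
Qed.
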